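(* (i) The cycles cross ratio $\langle C_1,C_2;C_3,C_4\rangle$ is a well-defined FLT-invariant of quadruples of cycles: whenever it is defined, its value does not depend on the choice of the homogeneous coordinates (equivalently, of the matrices, up to non-zero scalar factors) representing the cycles $C_1,C_2,C_3,C_4$, and for every invertible complex $2\times 2$ matrix $M$, if $C_i'$ denotes the image of the cycle $C_i$ under the action $C\mapsto \overline{M}CM^{-1}$ of the fractional linear transformation with matrix $M$ ($i=1,2,3,4$), then $$\langle C_1',C_2';C_3',C_4'\rangle=\langle C_1,C_2;C_3,C_4\rangle .$$ (ii) Let $Z_1,Z_2,Z_3,Z_4$ be the zero radius cycles representing points $z_1,z_2,z_3,z_4\in\mathbb{C}\cup\{\infty\}$ for which the cross ratio is defined. Then $$\langle Z_1,Z_2;Z_3,Z_4\rangle=\left|(z_1,z_2;z_3,z_4)\right|^2 .$$ (iii) For cycles $C,C_1,C_2,C_3,C_4$ the cancellation formula $$\langle C_1,C;C_3,C_4\rangle\,\langle C,C_2;C_3,C_4\rangle=\langle C_1,C_2;C_3,C_4\rangle$$ holds, whenever the cycles cross ratios involved are defined and the product on the left is not of the form $0\cdot\infty$.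
   Context: A cycle is a point $(k,l,n,m)$ of the real projective space $P\mathbb{R}^3$ (homogeneous coordinates, not all zero, up to a non-zero real factor); it stands for the equation $k(x^2+y^2)-2lx-2ny+m=0$ in $\mathbb{R}^2$ (the solution set may be empty). With $L=l+\mathrm{i}n$ it is represented by the matrix $$C=\begin{pmatrix}\overline{L}&-m\\ k&-L\end{pmatrix}.$$ The bar over a matrix denotes entrywise complex conjugation. The cycles product is $\langle C,C_1\rangle=-\operatorname{tr}(C\overline{C}_1)$, which equals $km_1+k_1m-2ll_1-2nn_1$ for cycles $(k,l,n,m)$ and $(k_1,l_1,n_1,m_1)$. A zero radius cycle represents a point: $z=x+\mathrm{i}y\in\mathbb{C}$ is represented by $(k,l,n,m)=(1,x,y,x^2+y^2)$, and $\infty$ by $(0,0,0,1)$. The fractional linear transformation (FLT) with invertible complex matrix $M=\begin{pmatrix}\alpha&\beta\\ \gamma&\delta\end{pmatrix}$ is $z\mapsto\frac{\alpha z+\beta}{\gamma z+\delta}$ on $\mathbb{C}\cup\{\infty\}$. It acts on cycles by $C\mapsto\overline{M}CM^{-1}$. For $\det M=1$ the matrix $\overline{M}CM^{-1}$ is again of the form $\begin{pmatrix}\overline{L'}&-m'\\ k'&-L'\end{pmatrix}$ with $k',m'\in\mathbb{R}$ and $L'\in\mathbb{C}$; for general $M$ it is a non-zero complex scalar multiple of a matrix $\begin{pmatrix}\overline{L'}&-m'\\ k'&-L'\end{pmatrix}$ with $k',m'\in\mathbb{R}$ and $L'\in\mathbb{C}$, and the image cycle is the one represented by that matrix (equivalently,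 replace $M$ by a scalar multiple of determinant $1$). The cycles cross ratio of four cycles is $$\langle C_1,C_2;C_3,C_4\rangle=\frac{\langle C_1,C_3\rangle}{\langle C_1,C_4\rangle}:\frac{\langle C_2,C_3\rangle}{\langle C_2,C_4\rangle}=\frac{\langle C_1,C_3\rangle\langle C_2,C_4\rangle}{\langle C_1,C_4\rangle\langle C_2,C_3\rangle}$$ if $\langle C_1,C_4\rangle\langle C_2,C_3\rangle\neq0$; it is $\infty$ if $\langle C_1,C_4\rangle\langle C_2,C_3\rangle=0$ but $\langle C_1,C_3\rangle\langle C_2,C_4\rangle\ne0$; it is undefined in the remaining case $\frac00$. The cross ratio of four points is $(z_1,z_2;z_3,z_4)=\frac{z_1-z_3}{z_1-z_4}:\frac{z_2-z_3}{z_2-z_4}=\frac{(z_1-z_3)(z_2-z_4)}{(z_1-z_4)(z_2-z_3)}$, with value $\infty$ if only the denominator vanishes, undefined if both numerator and denominator vanish. If some points are $\infty$, differences $z_i-z_j$ are replaced by determinants $u_iv_j-u_jv_i$ of homogeneous coordinates $[u_i:v_i]$ of the points ($z=[z:1]$, $\infty=[1:0]$). Put $|\infty|^2=\infty$. *)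

(* Defs.v *)
From HB Require Import structures.
From mathcomp Require Import all_boot all_order all_algebra.
From mathcomp Require Import reals complex ring lra.
Set Implicit Arguments.
Unset Strict Implicit.
Unset Printing Implicit Defensive.
Import Order.TTheory GRing.Theory Num.Theory.
Local Open Scope ring_scope.
Local Open Scope complex_scope.

Variant ratio_value (F : Type) := Finite of F | Infinite | Undefined.
Arguments Infinite {F}.
Arguments Undefined {F}.

Definition ratio (F : fieldType) (num den : F) : ratio_value F :=
  if den != 0 then Finite (num / den)
  else if num != 0 then Infinite else Undefined.

Definition zero_times_infinity (F : fieldType) (a b : ratio_value F) : Prop :=
  (a = Finite 0 /\ b = Infinite) \/ (a = Infinite /\ b = Finite 0).

Definition ratio_mul (F : fieldType) (a b : ratio_value F) : ratio_value F :=
  match a, b with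
  | Finite x, Finite y => Finite (x * y)
  | Finite x, Infinite => if x != 0 then Infinite else Undefined
  | Infinite, Finite y => if y != 0 then Infinite else Undefined
  | Infinite, Infinite => Infinite
  | _, _ => Undefined
  end.

Definition ratio_abs2 (F : numFieldType) (a : ratio_value F) : ratio_value F :=
  match a with
  | Finite x => Finite (`|x| ^+ 2)
  | Infinite => Infinite
  | Undefined => Undefined
  end.

(* A choice (k, l, n, m) of homogeneous coordinates of a cycle; two choices
   give the same cycle when they are related by [same_cycle]. *)
Record cycle_coords (R : realType) := CycleCoords {
  coords :> 'rV[R]_4;
  coords_neq0 : coords != 0
}.

Definition same_cycle (R : realType) (C D : cycle_coords R) : Prop :=
  exists2 a : R, a != 0 & coords D = a *: coords C.

Definition ck (R : realType) (C : 'rV[R]_4) : R := C 0 0.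
Definition cl (R : realType) (C : 'rV[R]_4) : R := C 0 1.
Definition cn (R : realType) (C : 'rV[R]_4) : R := C 0 2.
Definition cm (R : realType) (C : 'rV[R]_4) : R := C 0 3.
Definition cL (R : realType) (C : 'rV[R]_4) : R[i] := cl C +i* cn C.

Definition mx2 (T : pzRingType) (a b c d : T) : 'M[T]_2 :=
  \matrix_(i, j) nth 0 (nth [::] [:: [:: a; b]; [:: c; d]] i) j.

Definition cycle_mx (R : realType) (C : 'rV[R]_4) : 'M[R[i]]_2 :=
  mx2 (conjc (cL C)) (- (cm C)%:C)
      (ck C)%:C      (- cL C).

Definition conj_mx (R : realType) (A : 'M[R[i]]_2) : 'M[R[i]]_2 :=
  map_mx (@conjc R) A.

(* The matrices representing the cycle C, up to a non-zero complex factor. *)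
Definition represents (R : realType) (A : 'M[R[i]]_2) (C : cycle_coords R) :
    Prop :=
  exists2 c : R[i], c != 0 & A = c *: cycle_mx C.

(* C' are homogeneous coordinates of the image of C under the FLT of M; it
   exists and is unique as a cycle: [flt_image_exists], [flt_image_unique]. *)
Definition flt_image (R : realType) (M : 'M[R[i]]_2) (C C' : cycle_coords R) :
    Prop :=
  represents (conj_mx M *m cycle_mx C *m invmx M) C'.

(* On cycle matrices this is k m1 + k1 m - 2 l l1 - 2 n n1, embedded in R[i]:
   see [mx_product_cycles]. *)
Definition mx_product (R : realType) (A B : 'M[R[i]]_2) : R[i] :=
  - \tr (A *m conj_mx B).

Definition mx_cross_ratio (R : realType) (A1 A2 A3 A4 : 'M[R[i]]_2) :
    ratio_value R[i] :=
  ratio (mx_product A1 A3 * mx_product A2 A4)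
        (mx_product A1 A4 * mx_product A2 A3).

Definition cycles_cross_ratio (R : realType) (C1 C2 C3 C4 : cycle_coords R) :
    ratio_value R[i] :=
  mx_cross_ratio (cycle_mx C1) (cycle_mx C2) (cycle_mx C3) (cycle_mx C4).

(* [None] is the point at infinity. *)
Definition point (R : realType) : Type := option R[i].

(* Homogeneous coordinates [u : v], namely [z : 1] and [1 : 0]. *)
Definition hom_u (R : realType) (z : point R) : R[i] :=
  if z is Some w then w else 1.
Definition hom_v (R : realType) (z : point R) : R[i] :=
  if z is Some _ then 1 else 0.

(* Equal to z - w for finite z and w, see [point_diff_finite]. *)
Definition point_diff (R : realType) (z w : point R) : R[i] :=
  hom_u z * hom_v w - hom_u w * hom_v z.

Definition cross_ratio (R : realType) (z1 z2 z3 z4 : point R) :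
    ratio_value R[i] :=
  ratio (point_diff z1 z3 * point_diff z2 z4)
        (point_diff z1 z4 * point_diff z2 z3).

Definition zero_radius_row (R : realType) (z : point R) : 'rV[R]_4 :=
  if z is Some (x +i* y) then \row_j [:: 1; x; y; x ^+ 2 + y ^+ 2]`_j
  else \row_j [:: 0; 0; 0; 1]`_j.

Lemma zero_radius_row_neq0 (R : realType) (z : point R) :
  zero_radius_row z != 0.
Proof.
case: z => [[x y]|]; apply/eqP => /rowP.
- by move=> /(_ 0); rewrite !mxE /= => /eqP; rewrite oner_eq0.
- by move=> /(_ 3); rewrite !mxE /= => /eqP; rewrite oner_eq0.
Qed.

Definition zero_radius_cycle (R : realType) (z : point R) : cycle_coords R :=
  CycleCoords (zero_radius_row_neq0 z).

Lemma point_diff_finite (R : realType) (z w : R[i]) :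
  point_diff (Some z) (Some w) = z - w.
Proof. by rewrite /point_diff /= !mulr1. Qed.

Lemma mx2_eta (T : pzRingType) (A : 'M[T]_2) :
  A = mx2 (A 0 0) (A 0 1) (A 1 0) (A 1 1).
Proof.
apply/matrixP => i j; rewrite !mxE.
by case: i => -[|[|//]] ? /=; case: j => -[|[|//]] ? /=;
  congr (A _ _); apply: val_inj.
Qed.

Lemma mul_mx2 (T : pzRingType) (a b c d a' b' c' d' : T) :
  mx2 a b c d *m mx2 a' b' c' d' =
  mx2 (a * a' + b * c') (a * b' + b * d') (c * a' + d * c') (c * b' + d * d').
Proof.
by rewrite [LHS]mx2_eta; congr mx2;
  rewrite !mxE !big_ord_recl big_ord0 !mxE /= addr0.
Qed.

Lemma mx_product_cycles (R : realType) (C D : 'rV[R]_4) :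
  mx_product (cycle_mx C) (cycle_mx D) =
  (ck C * cm D + ck D * cm C - 2 * cl C * cl D - 2 * cn C * cn D)%:C.
Proof.
rewrite /mx_product /conj_mx.
have -> : map_mx (@conjc R) (cycle_mx D) =
    mx2 (cL D) (- (cm D)%:C) (ck D)%:C (- conjc (cL D)).
  by rewrite [LHS]mx2_eta; congr mx2; rewrite !mxE; apply/eqP;
    rewrite eq_complex /= ?opprK ?oppr0 !eqxx.
rewrite mul_mx2 /mxtrace !big_ord_recl big_ord0 !mxE /= addr0.
by apply/eqP; rewrite eq_complex /=; apply/andP; split; apply/eqP; simpc; ring.
Qed.

Lemma cycle_mx_inj (R : realType) : injective (@cycle_mx R).
Proof.
move=> C D /matrixP E; apply/rowP => j.
have := E 0 0; have := E 0 1; have := E 1 0.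
rewrite !mxE /= => -[Ek] [Em] [El En].
have {}En : C 0 2 = D 0 2 by apply: oppr_inj.
have {}Em : C 0 3 = D 0 3 by apply: oppr_inj.
by case: j => -[|[|[|[|//]]]] lj; [move: Ek|move: El|move: En|move: Em];
  rewrite /ck /cl; congr (_ = _); congr (_ _ _); apply: val_inj.
Qed.

Lemma cycle_mx0 (R : realType) : cycle_mx (0 : 'rV[R]_4) = 0.
Proof.
apply/matrixP => i j; rewrite !mxE /cL /ck /cl /cn /cm !mxE.
by case: i => -[|[|//]] ? /=; case: j => -[|[|//]] ? /=; rewrite ?oppr0 //;
  apply/eqP; rewrite eq_complex /= ?oppr0 eqxx.
Qed.

Lemma flt_image_exists (R : realType) (M : 'M[R[i]]_2) (C : cycle_coords R) :
  M \in unitmx -> exists C', flt_image M C C'.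
Proof.
move=> uM; set d := M 0 0 * M 1 1 - M 0 1 * M 1 0.
pose N : 'M[R[i]]_2 := mx2 (M 1 1) (- M 0 1) (- M 1 0) (M 0 0).
have MN : M *m N = d%:M.
  rewrite {1}(mx2_eta M) mul_mx2 [RHS]mx2_eta /d.
  by congr mx2; rewrite !mxE /=; ring.
have NE : N = d *: invmx M.
  by rewrite -(mulKmx uM N) MN mul_mx_scalar.
have d0 : d != 0.
  apply/eqP => d0; move: NE; rewrite d0 scale0r => N0.
  have M0 : M = 0.
    have h i j : N i j = 0 by rewrite N0 mxE.
    move: (h 0 0) (h 0 1) (h 1 0) (h 1 1); rewrite !mxE /=.
    move=> h11 /eqP; rewrite oppr_eq0 => /eqP h01 /eqP.
    rewrite oppr_eq0 => /eqP h10 h00.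
    by rewrite (mx2_eta M) h00 h01 h10 h11 [RHS]mx2_eta !mxE.
  by move: uM; rewrite M0 unitmxE det0 unitr0.
have [D DE] : exists D, D = conj_mx M *m cycle_mx C *m N by eexists.
have [D00 D01 D10] : [/\ D 0 0 = conjc (- D 1 1),
    D 0 1 = (complex.Re (D 0 1))%:C & D 1 0 = (complex.Re (D 1 0))%:C].
  rewrite DE (mx2_eta (conj_mx M)) !mul_mx2 /conj_mx !mxE /= /cL.
  move: (ck C) (cl C) (cn C) (cm C) => k l n m.
  case: (M 0 0) (M 0 1) (M 1 0) (M 1 1) => [a a'] [b b'] [c c'] [e e'].
  by split; apply/eqP; rewrite eq_complex /=; apply/andP; split; apply/eqP;
    ring.
pose v : 'rV[R]_4 :=
  \row_j [:: complex.Re (D 1 0); - complex.Re (D 1 1);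
              - complex.Im (D 1 1); - complex.Re (D 0 1)]`_j.
have Dv : D = cycle_mx v.
  rewrite [LHS]mx2_eta D00 D01 D10 /cycle_mx /cL /ck /cl /cn /cm !mxE /=.
  move: (D 0 1) (D 1 0) (D 1 1) => [p p'] [q q'] [r r'].
  by congr mx2; apply/eqP; rewrite eq_complex /= ?opprK ?oppr0 !eqxx.
have v0 : v != 0.
  apply/eqP => v0; have := coords_neq0 C; apply/negP; rewrite negbK.
  move: Dv; rewrite v0 cycle_mx0 DE NE -scalemxAr => /eqP.
  rewrite scaler_eq0 (negPf d0) /= => /eqP /(congr1 (mulmx^~ M)).
  rewrite /= mul0mx mulmxKV // => /(congr1 (mulmx (conj_mx (invmx M)))).
  rewrite mulmx0 mulmxA /conj_mx -map_mxM mulVmx // map_mx1 mul1mx.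
  by rewrite -cycle_mx0 => /cycle_mx_inj ->.
exists (CycleCoords v0), d^-1; first by rewrite invr_eq0.
by rewrite /= -Dv DE NE -scalemxAr scalerA mulVf // scale1r.
Qed.

Lemma flt_image_unique (R : realType) (M : 'M[R[i]]_2)
    (C C' C'' : cycle_coords R) :
  flt_image M C C' -> flt_image M C C'' -> same_cycle C' C''.
Proof.
move=> [c c0 E] [c' c'0]; rewrite E => E'.
have {E'}E' : cycle_mx C'' = (c'^-1 * c) *: cycle_mx C'.
  by rewrite -scalerA E' scalerA mulVf // scale1r.
case a_def : (c'^-1 * c) => [x y]; rewrite a_def in E'.
have y0 : y = 0.
  apply/eqP; apply: contraT => y0; have := coords_neq0 C'.
  suff -> : coords C' = 0 by rewrite eqxx.
  have := E' =>/matrixP H; move: (H 0 0) (H 0 1) (H 1 0) (H 1 1).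
  rewrite !mxE /= => -[h1 h2] [_ h3] [_ h4] [h5 h6] {H}.
  have yP (t : R) : y * t = 0 -> t = 0.
    by move=> /eqP; rewrite mulf_eq0 (negPf y0) => /eqP.
  have H0 : ck C' = 0 by apply: yP; lra.
  have H1 : cl C' = 0 by apply: yP; lra.
  have H2 : cn C' = 0 by apply: yP; lra.
  have H3 : cm C' = 0 by apply: yP; lra.
  apply/rowP => j; rewrite mxE.
  by case: j => -[|[|[|[|//]]]] lj; [rewrite -[RHS]H0|rewrite -[RHS]H1|
    rewrite -[RHS]H2|rewrite -[RHS]H3]; congr (_ _ _); apply: val_inj.
exists x.
  apply: contraTneq (coords_neq0 C'') => x0; rewrite negbK; apply/eqP.
  apply: cycle_mx_inj; rewrite E' x0 y0 cycle_mx0.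
  by rewrite -[0 +i* 0]/(0 : R[i]) scale0r.
apply: cycle_mx_inj; rewrite E' y0.
rewrite [LHS]mx2_eta; congr mx2; rewrite !mxE /= /cL /ck /cl /cn /cm !mxE;
  by apply/eqP; rewrite eq_complex /=; apply/andP; split; apply/eqP; ring.
Qed.

(* Main.v *)
Require Import Defs.
From HB Require Import structures.
From mathcomp Require Import all_boot all_order all_algebra.
From mathcomp Require Import reals complex ring.
Set Implicit Arguments.
Unset Strict Implicit.
Unset Printing Implicit Defensive.
Import Order.TTheory GRing.Theory Num.Theory.
Local Open Scope ring_scope.
Local Open Scope complex_scope.

(** The matrix form of the product is a trace, so it is sesquilinear and
    blind to conjugation of its two arguments by one FLT.  Sesquilinearity
    makes a change of representatives multiply both products of the cross
    ratio by the same factor, because each of the four cycles occurs exactly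
    once above and once below the fraction bar; the FLT factors cancel inside
    the trace.  These two facts, [mx_cross_ratio_scale] and
    [mx_product_flt], give (i); the image cycle is given by one more rescaling,
    which absorbs the determinant of the FLT matrix.

    For (ii), the product of two zero radius cycles is the squared modulus of
    the difference of the points ([zero_radius_product]), also at infinity
    when differences are read as determinants of homogeneous coordinates, and
    squared moduli commute with products and quotients.

    For (iii), the two fractions on the left share the factors
    [<C, C3>] and [<C, C4>] crosswise.  These cancel when both fractions are
    finite; otherwise an infinite fraction forces enough products to be
    non-zero to locate the vanishing one in the denominator on the right
    ([ratio_mul_cancel]). *)

(* Otherwise the name denotes the fractions of [fraction]. *)
Local Notation ratio := Defs.ratio.

Lemma ratio_scale (F : fieldType) (c num den : F) :
  c != 0 -> ratio (c * num) (c * den) = ratio num den.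
Proof.
move=> c0; rewrite /ratio !mulf_eq0 !(negPf c0) /=.
by rewrite -mulf_div divff // mul1r.
Qed.

Lemma ratio_abs2_ratio (F : numFieldType) (num den : F) :
  ratio_abs2 (ratio num den) = ratio (`|num| ^+ 2) (`|den| ^+ 2).
Proof.
rewrite /ratio !expf_eq0 /= !normr_eq0.
by case: eqP => _ /=; [case: eqP | rewrite normf_div expr_div_n].
Qed.

(** Here [p] and [q] stand for the products of a cycle with the third and the
    fourth cycle of a cross ratio.  If both fractions are finite, [p] and [q]
    are non-zero and cancel.  If one is infinite and the other is not [0],
    both numerators are non-zero, hence so are [p], [q], [p1] and [q2], and
    the vanishing denominator must come from [q1] or [p2]. *)
Lemma ratio_mul_cancel (F : fieldType) (p1 q1 p q p2 q2 : F) :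
  ratio (p1 * q) (q1 * p) <> Undefined ->
  ratio (p * q2) (q * p2) <> Undefined ->
  ~ zero_times_infinity (ratio (p1 * q) (q1 * p)) (ratio (p * q2) (q * p2)) ->
  ratio_mul (ratio (p1 * q) (q1 * p)) (ratio (p * q2) (q * p2)) =
  ratio (p1 * q2) (q1 * p2).
Proof.
rewrite /ratio /zero_times_infinity !mulf_eq0 !negb_or.
(* Splitting on the vanishing of each variable decides every test in [ratio];
   the surviving goals are contradictions, tests on the finite factor of an
   infinite product, and the single finite identity. *)
case: (eqVneq p1 0) => [->|p1n]; case: (eqVneq q1 0) => [->|q1n];
case: (eqVneq p 0) => [->|pn]; case: (eqVneq q 0) => [->|qn];
case: (eqVneq p2 0) => [->|p2n]; case: (eqVneq q2 0) => [->|q2n] //=;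
rewrite ?(mul0r, mulr0) ?eqxx //= => _ _ H; try (by case: H; auto);
try (by rewrite !mulf_neq0 ?invr_neq0 // mulf_neq0).
by congr (Defs.Finite _); field; rewrite p2n q1n qn pn.
Qed.

Lemma mx_productZ (R : realType) (a b : R[i]) (A B : 'M[R[i]]_2) :
  mx_product (a *: A) (b *: B) = a * conjc b * mx_product A B.
Proof.
by rewrite /mx_product /conj_mx map_mxZ -scalemxAl -scalemxAr scalerA mxtraceZ
  mulrN.
Qed.

(** The conjugate of the second argument carries [M] on its left and the
    inverse of [conj_mx M] on its right: the first meets [invmx M] in the
    middle, the second meets [conj_mx M] around the trace. *)
Lemma mx_product_flt (R : realType) (M A B : 'M[R[i]]_2) :
  M \in unitmx ->
  mx_product (conj_mx M *m A *m invmx M) (conj_mx M *m B *m invmx M) =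
  mx_product A B.
Proof.
move=> uM; rewrite /mx_product /conj_mx !map_mxM.
have -> : map_mx (@conjc R) (map_mx (@conjc R) M) = M.
  by apply/matrixP => i j; rewrite !mxE conjcK.
rewrite !mulmxA mulmxKV // mxtrace_mulC !mulmxA -map_mxM mulVmx //.
by rewrite map_mx1 mul1mx.
Qed.

(** Numerator and denominator are both multiplied by
    [a1 * a2 * conjc a3 * conjc a4]. *)
Lemma mx_cross_ratio_scale (R : realType) (a1 a2 a3 a4 : R[i])
    (A1 A2 A3 A4 : 'M[R[i]]_2) :
  a1 != 0 -> a2 != 0 -> a3 != 0 -> a4 != 0 ->
  mx_cross_ratio (a1 *: A1) (a2 *: A2) (a3 *: A3) (a4 *: A4) =
  mx_cross_ratio A1 A2 A3 A4.
Proof.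
move=> a10 a20 a30 a40; rewrite /mx_cross_ratio !mx_productZ.
rewrite -[RHS](@ratio_scale _ (a1 * a2 * conjc a3 * conjc a4)); last first.
  by rewrite !mulf_neq0 // conjc_eq0.
by congr ratio; ring.
Qed.

Lemma mx_cross_ratio_represents (R : realType) (C1 C2 C3 C4 : cycle_coords R)
    (A1 A2 A3 A4 : 'M[R[i]]_2) :
  represents A1 C1 -> represents A2 C2 ->
  represents A3 C3 -> represents A4 C4 ->
  mx_cross_ratio A1 A2 A3 A4 = cycles_cross_ratio C1 C2 C3 C4.
Proof.
move=> [a1 a10 ->] [a2 a20 ->] [a3 a30 ->] [a4 a40 ->].
exact: mx_cross_ratio_scale.
Qed.

Lemma cycle_mxZ (R : realType) (a : R) (C : 'rV[R]_4) :
  cycle_mx (a *: C) = a%:C *: cycle_mx C.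
Proof.
rewrite [LHS]mx2_eta [RHS]mx2_eta; congr mx2;
  rewrite !mxE /= /cL /ck /cl /cn /cm !mxE; apply/eqP;
  by rewrite eq_complex /=; apply/andP; split; apply/eqP; ring.
Qed.

Lemma represents_same_cycle (R : realType) (C D : cycle_coords R) :
  same_cycle C D -> represents (cycle_mx D) C.
Proof.
move=> [a a0 ->]; exists a%:C; last exact: cycle_mxZ.
by rewrite fmorph_eq0.
Qed.

(** For finite points this is the expansion of
    [(x - x') ^+ 2 + (y - y') ^+ 2]; a finite point and infinity give [1], the
    coefficient [k] of the finite one. *)
Lemma zero_radius_product (R : realType) (z w : point R) :
  mx_product (cycle_mx (zero_radius_cycle z)) (cycle_mx (zero_radius_cycle w)) =
  `|point_diff z w| ^+ 2.
Proof.
rewrite mx_product_cycles normCK /ck /cl /cn /cm.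
by case: z w => [[x y]|] [[x' y']|]; rewrite /point_diff !mxE /=; apply/eqP;
  rewrite eq_complex /=; apply/andP; split; apply/eqP; ring.
Qed.

Theorem proposition7 (R : realType) :
  [/\ (* (i) *)
      forall C1 C2 C3 C4 : cycle_coords R,
        cycles_cross_ratio C1 C2 C3 C4 <> Undefined ->
        [/\ forall D1 D2 D3 D4 : cycle_coords R,
              same_cycle C1 D1 -> same_cycle C2 D2 ->
              same_cycle C3 D3 -> same_cycle C4 D4 ->
              cycles_cross_ratio D1 D2 D3 D4 = cycles_cross_ratio C1 C2 C3 C4,
            forall A1 A2 A3 A4 : 'M[R[i]]_2,
              represents A1 C1 -> represents A2 C2 ->
              represents A3 C3 -> represents A4 C4 ->
              mx_cross_ratio A1 A2 A3 A4 = cycles_cross_ratio C1 C2 C3 C4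
          & forall M : 'M[R[i]]_2, M \in unitmx ->
            forall C1' C2' C3' C4' : cycle_coords R,
              flt_image M C1 C1' -> flt_image M C2 C2' ->
              flt_image M C3 C3' -> flt_image M C4 C4' ->
              cycles_cross_ratio C1' C2' C3' C4' =
              cycles_cross_ratio C1 C2 C3 C4],
      (* (ii) *)
      forall z1 z2 z3 z4 : point R,
        cross_ratio z1 z2 z3 z4 <> Undefined ->
        cycles_cross_ratio (zero_radius_cycle z1) (zero_radius_cycle z2)
                           (zero_radius_cycle z3) (zero_radius_cycle z4) =
        ratio_abs2 (cross_ratio z1 z2 z3 z4)
    & (* (iii) *)
      forall C C1 C2 C3 C4 : cycle_coords R,
        cycles_cross_ratio C1 C C3 C4 <> Undefined ->
        cycles_cross_ratio C C2 C3 C4 <> Undefined ->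
        cycles_cross_ratio C1 C2 C3 C4 <> Undefined ->
        ~ zero_times_infinity (cycles_cross_ratio C1 C C3 C4)
                              (cycles_cross_ratio C C2 C3 C4) ->
        ratio_mul (cycles_cross_ratio C1 C C3 C4)
                  (cycles_cross_ratio C C2 C3 C4) =
        cycles_cross_ratio C1 C2 C3 C4].
Proof.
split.
- move=> C1 C2 C3 C4 _; split.
  + by move=> *; apply: mx_cross_ratio_represents; apply: represents_same_cycle.
  + exact: mx_cross_ratio_represents.
  + move=> M uM C1' C2' C3' C4' I1 I2 I3 I4.
    rewrite -(mx_cross_ratio_represents I1 I2 I3 I4).
    by rewrite /cycles_cross_ratio /mx_cross_ratio !mx_product_flt.
- move=> z1 z2 z3 z4 _.
  rewrite /cycles_cross_ratio /mx_cross_ratio !zero_radius_product.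
  by rewrite ratio_abs2_ratio !normrM !exprMn.
- move=> C C1 C2 C3 C4 D1 D2 _.
  exact: ratio_mul_cancel.
Qed.
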